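(* Suppose $\frac nk\ge6$, $\theta\in[k]^n$ is balanced, and $k\asymp1$. Let $\mathcal M:\{0,1\}^{n\times n}\to\mathbf M_{n\times k}$ be a symmetric $(\epsilon,\delta)$-node DP mechanism. Suppose $A\sim SBM(n,k,B,\theta)$. If $\mathbb P(\widetilde{\mathcal L}(\mathcal M(A),\theta)\le\xi)\ge1-\eta$ with $\xi\in(0,1/3)$, then $$\epsilon\ge\frac12\log\left(\frac{1-\eta-\xi-2k\delta}{\eta+\xi+2k\delta}\right)+\frac12\log(k-1).$$ In particular, if $\eta,\xi,\delta=O\left(\frac{1}{\mathrm{poly}(n)}\right)$, then $\epsilon\succsim\log n$. Moreover, if $\eta=O\left(\frac{1}{\log n}\right)$ and $\xi,\delta=O\left(\frac{1}{\mathrm{poly}(n)}\right)$, then $\epsilon\succsim\log(\log n)$.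
   Context: Asymptotics: parameters may depend on $n$. $f\succsim g$ means $f(n)\ge c\,g(n)$ for all sufficiently large $n$, for a constant $c>0$; $f\asymp g$ means both $f\succsim g$ and $g\succsim f$. $\mathrm{poly}(n)$ denotes a quantity of order $\Theta(n^\alpha)$ for some constant $\alpha>0$, possibly different at each occurrence. $\mathbf M_{n\times k}$ is the set of $n\times k$ matrices with exactly one $1$ in each row and $0$ otherwise; $\hat\theta\in[k]^n$ is identified with its one-hot encoding in $\mathbf M_{n\times k}$. $\theta$ is balanced if $|\{i:\theta_i=j\}|=n/k$ for all $j\in[k]$. For symmetric invertible $B\in(0,1]^{k\times k}$, $A\sim SBM(n,k,B,\theta)$ has independent $A_{ij}\sim\mathrm{Ber}(B_{\theta_i,\theta_j})$ for $i<j$, $A_{ji}=A_{ij}$, zero diagonal. Two graphs are node-adjacent if one can be obtained from the other by rewiring at most one node (changing the corresponding row and column of the adjacency matrix). A randomized mechanism $\mathcal M$ is $(\epsilon,\delta)$-node DP if $\mathbb P(\mathcal M(A)\in S)\le e^\epsilon\mathbb P(\mathcal M(A')\in S)+\delta$ for all node-adjacent $A,A'$ and all measurable $S$. $\mathcal M$ is symmetric if for every $\hat\theta$, every $A\in\{0,1\}^{n\times n}$ and every deterministic $n\times n$ permutation matrix $L$, $\mathbb P(\mathcal M(A)=\hat\theta)=\mathbb P(\mathcal M(LAL^T)=L\hat\theta)$. With $C_j=\{i:\theta_i=j\}$ and $S_k$ the permutation group of $[k]$, $\widetilde{\mathcal L}(\hat\theta,\theta)=\min_{\sigma\in S_k}\max_{j\in[k]}\frac{2}{|C_j|}\sum_{i\in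 C_j}\mathbf 1\{\sigma(\hat\theta_i)\ne j\}$. *)

(* Defs.v *)
(* MathComp / MathComp-Analysis. *)
From mathcomp Require Import all_boot all_order all_fingroup all_algebra.
From mathcomp Require Import all_classical all_reals all_analysis.

Set Implicit Arguments.
Unset Strict Implicit.
Unset Printing Implicit Defensive.

Import Order.TTheory GRing.Theory Num.Theory.
Import numFieldNormedType.Exports.

Local Open Scope classical_set_scope.
Local Open Scope ring_scope.

(* Asymptotic comparisons of functions of n are taken as n -> oo inside a set
   D of admissible sizes: a balanced assignment only exists when k n divides n.
   Big-O is the library's [f =O_ (within D \oo) g]. *)
Definition gtrsim (R : realType) (D : set nat) (f g : nat -> R) : Prop :=
  exists2 c : R, 0 < c & \forall n \near (within D \oo), c * g n <= f n.

Definition asymp (R : realType) (D : set nat) (f g : nat -> R) : Prop :=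
  gtrsim D f g /\ gtrsim D g f.

Definition is_poly_order (R : realType) (D : set nat) (p : nat -> R) : Prop :=
  exists2 alpha : R, 0 < alpha & asymp D p (fun n => n%:R `^ alpha).

Definition bigO_inv_poly (R : realType) (D : set nat) (f : nat -> R) : Prop :=
  exists2 p : nat -> R,
    is_poly_order D p & f =O_ (within D \oo) (fun n => (p n)^-1).

Record fdist (R : realType) (T : finType) := FDist {
  pmf :> T -> R;
  pmf_ge0 : forall t, 0 <= pmf t;
  pmf_sum1 : \sum_t pmf t = 1 }.

Definition Pr (R : realType) (T : finType) (d : fdist R T) (S : {set T}) : R :=
  \sum_(t in S) d t.

(* An element of [k]^n; it stands for its one-hot encoding, an n x k matrix with
   exactly one 1 in each row. *)
Notation labeling n k := {ffun 'I_n -> 'I_k} (only parsing).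

Definition onehot (R : realType) n k (t : labeling n k) : 'M[R]_(n, k) :=
  \matrix_(i, j) (t i == j)%:R.

Definition adjmx (R : realType) n (A : 'M[bool]_n) : 'M[R]_n :=
  \matrix_(i, j) (A i j)%:R.

(* For the permutation matrix L = perm_mx s, these are A |-> L A L^T and
   t |-> L t; see adjmx_relabel and onehot_relabel. *)
Definition relabel_graph n (s : 'S_n) (A : 'M[bool]_n) : 'M[bool]_n :=
  \matrix_(i, j) A (s i) (s j).

Definition relabel n k (s : 'S_n) (t : labeling n k) : labeling n k :=
  [ffun i => t (s i)].

Lemma adjmx_relabel (R : realType) n (s : 'S_n) (A : 'M[bool]_n) :
  adjmx R (relabel_graph s A) = perm_mx s *m adjmx R A *m (perm_mx s)^T.
Proof.
rewrite tr_perm_mx -row_permE -col_permE.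
by apply/matrixP => i j; rewrite !mxE.
Qed.

Lemma onehot_relabel (R : realType) n k (s : 'S_n) (t : labeling n k) :
  onehot R (relabel s t) = perm_mx s *m onehot R t.
Proof. by rewrite -row_permE; apply/matrixP => i j; rewrite !mxE ffunE. Qed.

Definition is_graph n (A : 'M[bool]_n) : bool :=
  (A^T == A) && [forall i, ~~ A i i].

Definition node_adjacent n (A A' : 'M[bool]_n) : Prop :=
  exists v : 'I_n, forall i j : 'I_n, i != v -> j != v -> A i j = A' i j.

Definition mechanism (R : realType) (n k : nat) : Type :=
  'M[bool]_n -> fdist R (labeling n k).

Definition node_DP (R : realType) n k (eps delta : R)
    (M : mechanism R n k) : Prop :=
  forall A A' : 'M[bool]_n, is_graph A -> is_graph A' -> node_adjacent A A' ->
  forall S : {set labeling n k},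
    Pr (M A) S <= expR eps * Pr (M A') S + delta.

Definition symmetric_mechanism (R : realType) n k (M : mechanism R n k) : Prop :=
  forall (t : labeling n k) (A : 'M[bool]_n) (s : 'S_n),
    M A t = M (relabel_graph s A) (relabel s t).

Definition community n k (theta : labeling n k) (j : 'I_k) : {set 'I_n} :=
  [set i | theta i == j].

Definition balanced (R : realType) n k (theta : labeling n k) : Prop :=
  forall j : 'I_k, #|community theta j|%:R = n%:R / k%:R :> R.

Definition max_community_loss (R : realType) n k (t theta : labeling n k)
    (sigma : 'S_k) : R :=
  \big[Num.max/0]_(j < k)
    (2 / #|community theta j|%:R
     * \sum_(i in community theta j) (sigma (t i) != j)%:R).

(* The neutral index of the minimum is the value at the identity permutation,
   hence one of the values being minimized. *)
Definition loss (R : realType) n k (t theta : labeling n k) : R :=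
  \big[Num.min/max_community_loss R t theta 1%g]_(sigma : 'S_k)
    max_community_loss R t theta sigma.

Definition sbm_matrix (R : realType) k (B : 'M[R]_k) : Prop :=
  [/\ B^T = B, B \in unitmx & forall a b, 0 < B a b <= 1].

Definition bernoulli_weight (R : realType) (p : R) (b : bool) : R :=
  if b then p else 1 - p.

(* Joint law of the adjacency matrix: the entries above the diagonal are
   independent, the rest is determined by symmetry and zero diagonal. *)
Definition sbm_weight (R : realType) n k (B : 'M[R]_k) (theta : labeling n k)
    (A : 'M[bool]_n) : R :=
  if is_graph A then
    \prod_(i < n) \prod_(j < n | (i < j)%N)
      bernoulli_weight (B (theta i) (theta j)) (A i j)
  else 0.

Lemma sbm_weight_ge0 (R : realType) n k (B : 'M[R]_k) (theta : labeling n k) A :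
  sbm_matrix B -> 0 <= sbm_weight B theta A.
Proof.
move=> [_ _ B01]; rewrite /sbm_weight; case: ifP => // _.
apply: prodr_ge0 => i _; apply: prodr_ge0 => j _.
have /andP[B0 B1] := B01 (theta i) (theta j).
by rewrite /bernoulli_weight; case: ifP => _; rewrite ?subr_ge0 // ltW.
Qed.

Lemma sbm_weight_sum1 (R : realType) n k (B : 'M[R]_k) (theta : labeling n k) :
  \sum_A sbm_weight B theta A = 1.
Proof.
pose P := fun p : 'I_n * 'I_n => (p.1 < p.2)%N.
pose w := fun (p : 'I_n * 'I_n) b =>
  bernoulli_weight (B (theta p.1) (theta p.2)) b.
transitivity (\prod_(p | P p) \sum_(b | true) w p b); last first.
  by apply: big1 => p _; rewrite big_bool /w /= addrC subrK.
rewrite (big_distr_big_dep false P (fun _ => xpredT)) /= -big_mkcond /=.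
pose gr := fun f : {ffun 'I_n * 'I_n -> bool} =>
  (\matrix_(i, j) (f (i, j) || f (j, i)))%R : 'M[bool]_n.
pose up := fun A : 'M[bool]_n => [ffun p : 'I_n * 'I_n => P p && A p.1 p.2].
rewrite (reindex_onto gr up) /=; last first.
  move=> A /andP[/eqP sA /forallP dA]; apply/matrixP => i j.
  rewrite !mxE !ffunE /P /= -[in A j i]sA mxE.
  case: ltngtP => [ij|ji|/ord_inj ->] /=; rewrite ?orbF ?(negbTE (dA j)) //.
apply: eq_big => [f | f /andP[_ /eqP uf]].
  apply/andP/pfamilyP => [[_ /eqP <-] | [/fintype.subsetP sf _]].
    by split=> //; apply/fintype.subsetP => p; rewrite !inE ffunE -[p \in P]/(P p);
      case: (P p).
  have f0 p : ~~ P p -> f p = false.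
    by apply: contraNF => fp; have := sf p; rewrite !inE fp; apply.
  split.
    apply/andP; split; first by apply/eqP/matrixP => i j; rewrite !mxE orbC.
    by apply/forallP => i; rewrite mxE f0 // /P /= ltnn.
  apply/eqP/ffunP => -[i j]; rewrite ffunE mxE /P /=.
  case: ltnP => [ij|ji] /=; last by rewrite f0 // /P /= -leqNgt.
  by rewrite (f0 (j, i)) ?orbF // /P /= -leqNgt ltnW.
rewrite pair_big_dep; apply: eq_bigr => -[i j] /= ij.
by rewrite /w /= -[in RHS]uf ffunE /P /= ij.
Qed.

Definition sbm (R : realType) n k (B : 'M[R]_k) (hB : sbm_matrix B)
    (theta : labeling n k) : fdist R 'M[bool]_n :=
  FDist (fun A => sbm_weight_ge0 theta A hB) (sbm_weight_sum1 B theta).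

(* P (M(A) \in S) for a random input A ~ d, the internal randomness of M being
   independent of A. *)
Definition Pr_output (R : realType) n k (d : fdist R 'M[bool]_n)
    (M : mechanism R n k) (S : {set labeling n k}) : R :=
  \sum_A d A * Pr (M A) S.

(* Main.v *)
Require Import Defs.
From mathcomp Require Import all_boot all_order all_fingroup all_algebra.
From mathcomp Require Import all_classical all_reals all_analysis.
From mathcomp Require Import ring lra zify.

Set Implicit Arguments.
Unset Strict Implicit.
Unset Printing Implicit Defensive.

Import Order.TTheory GRing.Theory Num.Theory.
Import numFieldNormedType.Exports.

Local Open Scope classical_set_scope.
Local Open Scope ring_scope.

(** Write Q for the law of M(A) when A is drawn from the block model, and let
    the community of a vertex under a labelling t be read off after matching
    the label names with the true communities.

    Exchanging two vertices u and v of a graph rewires only these two vertices,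
    hence is reached in two node-adjacent steps, and a symmetric mechanism
    answers the exchanged graph with the exchanged labelling. Privacy therefore
    makes Q almost invariant under exchanges ([output_law_swap]):
    Q(exchanged S) <= e^(2 eps) Q(S) + (1 + e^eps) delta.

    Take u in community a and, for every b <> a, let S_(u,b) be the event that u
    is placed in community b. If v lies in b and is placed correctly, exchanging
    u and v lands in S_(u,b). Under an accurate labelling nearly every v in b is
    placed correctly, so each of the k - 1 events S_(u,b) keeps probability at
    least about e^(-2 eps). They are disjoint, and on average over u in a they
    have total probability at most eta + xi / 2, since they all are errors.
    Comparing the two bounds ([swap_invariance_bound]) gives
    (k - 1) (1 - x) <= e^(2 eps) x with x = eta + xi + 2 k delta
    ([privacy_accuracy_tradeoff]), and logarithms give the first claim.

    For the two rates, this inequality and 2 <= k show that if x = O(1 / g)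
    with g tending to infinity then eps is at least of order log g
    ([decays_lower_bound]). The choices are g(n) = n^alpha, with the smallest of
    the three exponents, and g(n) = log n, which n^alpha dominates. *)

(** * Finite probability and the law of the output *)

Section FiniteLaws.
Variables (R : realType) (T : finType).
Implicit Types (d : fdist R T) (S : {set T}).

Lemma PrE d S : Pr d S = \sum_t d t * (t \in S)%:R.
Proof.
rewrite /Pr big_mkcond; apply: eq_bigr => t _.
by case: ifP; rewrite ?mulr1 ?mulr0.
Qed.

Lemma Pr_le1 d S : Pr d S <= 1.
Proof.
apply: (@le_trans _ _ (\sum_t d t)); last by rewrite Defs.pmf_sum1.
rewrite PrE; apply: ler_sum => t _.
by case: (t \in S); rewrite ?mulr1 ?mulr0 ?Defs.pmf_ge0.
Qed.

Lemma Pr_set0 d : Pr d finset.set0 = 0.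
Proof. by rewrite /Pr big_set0. Qed.

End FiniteLaws.

Section OutputLaw.
Variables (R : realType) (n k : nat).
Variables (d : fdist R 'M[bool]_n) (M : mechanism R n k).

Let output_ge0 t : 0 <= \sum_A d A * M A t.
Proof. by apply: sumr_ge0 => A _; rewrite mulr_ge0 ?Defs.pmf_ge0. Qed.

Let output_sum1 : \sum_t \sum_A d A * M A t = 1.
Proof.
rewrite exchange_big -(Defs.pmf_sum1 d); apply: eq_bigr => A _.
by rewrite -mulr_sumr Defs.pmf_sum1 mulr1.
Qed.

Definition output_law : fdist R (labeling n k) := FDist output_ge0 output_sum1.

Lemma Pr_outputE S : Pr_output d M S = Pr output_law S.
Proof.
rewrite /Pr exchange_big; apply: eq_bigr => A _.
by rewrite mulr_sumr.
Qed.
End OutputLaw.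

(** * Privacy makes the output law almost exchangeable *)

Section Privacy.
Variables (R : realType) (n k : nat) (M : mechanism R n k).
Implicit Types (S : {set labeling n k}) (A : 'M[bool]_n).

Lemma relabelK (u v : 'I_n) : involutive (@relabel n k (tperm u v)).
Proof. by move=> t; apply/ffunP => i; rewrite !ffunE tpermK. Qed.

Lemma Pr_relabel_graph (u v : 'I_n) A S : symmetric_mechanism M ->
  Pr (M (relabel_graph (tperm u v) A)) S
  = Pr (M A) [set t | relabel (tperm u v) t \in S]%SET.
Proof.
move=> symM; rewrite /Pr (reindex_inj (inv_inj (relabelK u v))) /=.
by apply: eq_big => t; rewrite ?inE // => _; rewrite -symM.
Qed.

Lemma is_graph_relabel (s : 'S_n) (A : 'M[bool]_n) :
  is_graph A -> is_graph (relabel_graph s A).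
Proof.
move=> /andP[/eqP sA /forallP dA]; apply/andP; split.
  by apply/eqP/matrixP => i j; rewrite !mxE -[in RHS]sA mxE.
by apply/forallP => i; rewrite mxE dA.
Qed.

Lemma is_graphP (A : 'M[bool]_n) :
  is_graph A -> (forall i j, A i j = A j i) /\ (forall i, ~~ A i i).
Proof.
case/andP => /eqP sA /forallP dA; split => // i j.
by rewrite -[in LHS]sA mxE.
Qed.

(** The intermediate graph takes the edges at u from the exchanged graph and all
    the others from A; it differs from A only at u, and from the exchanged graph
    only at v. *)
Lemma swap_two_rewirings (u v : 'I_n) (A : 'M[bool]_n) : is_graph A ->
  exists A1, [/\ is_graph A1, node_adjacent (relabel_graph (tperm u v) A) A1
               & node_adjacent A1 A].
Proof.
move=> gA; have gB := is_graph_relabel (tperm u v) gA.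
have [sA dA] := is_graphP gA; have [sB dB] := is_graphP gB.
exists (\matrix_(i, j) if (i == u) || (j == u)
         then relabel_graph (tperm u v) A i j else A i j); split.
- apply/andP; split; last by apply/forallP => i; rewrite mxE; case: ifP.
  apply/eqP/matrixP => i j; rewrite mxE [LHS]mxE [RHS]mxE orbC.
  by rewrite sA sB.
- exists v => i j iv jv; rewrite [RHS]mxE; case: ifPn => // /norP[iu ju].
  by rewrite mxE !tpermD // eq_sym.
- by exists u => i j iu ju; rewrite mxE (negbTE iu) (negbTE ju).
Qed.

(** Two successive uses of privacy multiply the factors; the delta of the second
    step is amplified by the factor of the first. *)
Lemma node_DP_swap (eps delta : R) (u v : 'I_n) (A : 'M[bool]_n) S :
  symmetric_mechanism M -> node_DP eps delta M -> is_graph A ->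
  Pr (M A) [set t | relabel (tperm u v) t \in S]%SET
  <= expR eps ^+ 2 * Pr (M A) S + (1 + expR eps) * delta.
Proof.
move=> symM dpM gA; rewrite -Pr_relabel_graph //.
have [A1 [gA1 adj1 adj2]] := swap_two_rewirings u v gA.
have step1 := dpM _ _ (is_graph_relabel (tperm u v) gA) gA1 adj1 S.
have step2 := dpM _ _ gA1 gA adj2 S.
apply: (le_trans step1); rewrite -subr_ge0.
have -> : expR eps ^+ 2 * Pr (M A) S + (1 + expR eps) * delta -
  (expR eps * Pr (M A1) S + delta) =
  expR eps * (expR eps * Pr (M A) S + delta - Pr (M A1) S) by ring.
by rewrite mulr_ge0 ?expR_ge0 // subr_ge0.
Qed.


(** The block model is supported on graphs, so the bound for each graph can be
    averaged although privacy says nothing about other matrices. *)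
Lemma output_law_swap (B : 'M[R]_k) (hB : sbm_matrix B) (theta : labeling n k)
    (eps delta : R) (u v : 'I_n) S :
  symmetric_mechanism M -> node_DP eps delta M ->
  Pr (output_law (sbm hB theta) M) [set t | relabel (tperm u v) t \in S]%SET
  <= expR eps ^+ 2 * Pr (output_law (sbm hB theta) M) S + (1 + expR eps) * delta.
Proof.
move=> symM dpM; rewrite -!Pr_outputE /Pr_output.
rewrite -[leRHS](_ : \sum_A sbm hB theta A *
   (expR eps ^+ 2 * Pr (M A) S + (1 + expR eps) * delta) = _); last first.
  under eq_bigr do rewrite mulrDr mulrCA.
  by rewrite big_split /= -mulr_sumr -mulr_suml (Defs.pmf_sum1 (sbm hB theta)) mul1r.
apply: ler_sum => A _; have [gA|ngA] := boolP (is_graph A).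
  by rewrite ler_wpM2l ?Defs.pmf_ge0 // node_DP_swap.
by rewrite /= /sbm_weight (negbTE ngA) !mul0r.
Qed.
End Privacy.

(** * Communities recovered by a labelling *)

Section Alignment.
Variables (n k : nat) (theta : labeling n k).
Implicit Types (t : labeling n k) (sigma : 'S_k) (u v : 'I_n).

Definition misclassified t sigma (j : 'I_k) : nat :=
  #|[set i in community theta j | sigma (t i) != j]%SET|.

(** The bound 1/3 leaves a strict majority in each community, which makes sigma
    unique, and leaves room for one exchange after an accurate labelling. *)
Definition aligned t sigma : bool :=
  [forall j, 3 * misclassified t sigma j < #|community theta j|]%N.

Definition assigned u (b : 'I_k) : {set labeling n k} :=
  [set t | [exists sigma, aligned t sigma && (sigma (t u) == b)]]%SET.

(** Errors of sigma and tau cover less than two thirds of community j, so some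
    vertex of it is labelled correctly by both; its label is the preimage of j
    under sigma and under tau. *)
Lemma aligned_inj t sigma tau : aligned t sigma -> aligned t tau -> sigma = tau.
Proof.
move=> /forallP s3 /forallP t3.
suff inv_eq j : (sigma^-1)%g j = (tau^-1)%g j.
  apply: invg_inj; apply/permP => j; exact: inv_eq.
have [i /setDP[]] : exists i, i \in (community theta j :\:
    ([set i in community theta j | sigma (t i) != j] :|:
     [set i in community theta j | tau (t i) != j]))%SET.
  apply/set0Pn; rewrite -card_gt0 cardsD.
  have := s3 j; have := t3 j; rewrite /misclassified.
  set X := [set i in _ | sigma (t i) != j]%SET.
  set Y := [set i in _ | tau (t i) != j]%SET.
  have := leq_card_setU X Y.
  have := subset_leq_card (finset.subsetIr (community theta j) (X :|: Y)%SET).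
  move=> leI [leU _] ltY ltX; rewrite subn_gt0 (leq_ltn_trans leI) //.
  rewrite (leq_ltn_trans leU) //; move: ltX ltY.
  by move: #|X| #|Y| #|_| => x y c; lia.
move=> iC; rewrite !inE in iC *; rewrite iC /= => /norP[/negPn/eqP <- /negPn].
by move/eqP => e; rewrite permK; apply: (canRL (permK tau)); rewrite -e.
Qed.

Lemma mem_assigned t sigma u b :
  aligned t sigma -> (t \in assigned u b) = (sigma (t u) == b).
Proof.
move=> al; rewrite inE; apply/existsP/idP => [[tau /andP[al' /eqP <-]]|eb].
  by rewrite (aligned_inj al al').
by exists sigma; rewrite al.
Qed.

(** As u and v lie in different communities, each community contains at most one
    of them and gains at most one error. Since 1 is at most a sixth of a
    community, an error fraction below 1/6 stays below 1/3. *)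
Lemma aligned_swap t sigma u v :
    (forall j, 6 <= #|community theta j|)%N ->
    (forall j, 6 * misclassified t sigma j < #|community theta j|)%N ->
    theta u != theta v ->
  aligned (relabel (tperm u v) t) sigma.
Proof.
move=> c6 m6 uv; apply/forallP => j.
suff le_mis : (misclassified (relabel (tperm u v) t) sigma j
    <= (misclassified t sigma j).+1)%N by have := m6 j; have := c6 j; lia.
(* The only vertex of community j, if any, whose label may change. *)
pose w := if theta u == j then u else v.
apply: leq_trans (_ : #|w |: [set i in community theta j | sigma (t i) != j]|%SET
  <= _)%N; last by rewrite cardsU1 /misclassified; case: (_ \notin _).
apply/subset_leq_card/fintype.subsetP => i; rewrite !inE ffunE /w.
case/andP => /eqP <-; case: tpermP => [-> _|-> _|_ _ ->].
- by rewrite !eqxx.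
- by rewrite (negbTE uv) eqxx.
- by rewrite eqxx orbT.
Qed.

Lemma sum_assigned_in_home t sigma (R : realType) (j : 'I_k) :
  \sum_(i in community theta j) (sigma (t i) == j)%:R
  = #|community theta j|%:R - (misclassified t sigma j)%:R :> R.
Proof.
rewrite /misclassified -!sum1_card !natr_sum.
rewrite [X in _ - X](_ : _ = \sum_(i in community theta j) (sigma (t i) != j)%:R).
  rewrite -sumrB; apply: eq_bigr => i _.
  by case: eqP; rewrite ?subr0 ?subrr.
rewrite big_mkcond [RHS]big_mkcond; apply: eq_bigr => i _.
by rewrite !inE; case: (theta i == j) => //=; case: (sigma _ != j).
Qed.

Lemma loss_le_misclassified (R : realType) t (xi : R) :
    (forall j, 0 < #|community theta j|)%N -> loss R t theta <= xi ->
  exists sigma, forall j,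
    (misclassified t sigma j)%:R <= xi / 2 * #|community theta j|%:R :> R.
Proof.
move=> c0.
have [sigma ->] : exists sigma, loss R t theta = max_community_loss R t theta sigma.
  rewrite /loss; elim/big_ind: _ => [|x y [s1 ->] [s2 ->]|s _]; first by exists 1%g.
    by rewrite /Order.min; case: ifP; [exists s1 | exists s2].
  by exists s.
move=> le_xi; exists sigma => j.
have le_j := le_trans (le_bigmax _ _ j) le_xi.
have cj : 0 < #|community theta j|%:R :> R by rewrite ltr0n.
rewrite -(@ler_pM2l _ (2 / #|community theta j|%:R)) ?divr_gt0 ?ltr0n //.
rewrite [leRHS](_ : _ = xi); last by field; rewrite gt_eqF.
apply: le_trans le_j; rewrite ler_pM2l ?divr_gt0 ?ltr0n //.
rewrite /misclassified -sum1_card natr_sum big_mkcond [leRHS]big_mkcond.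
by apply: ler_sum => i _; rewrite !inE; case: (theta i == j); case: (sigma _ != j).
Qed.
End Alignment.

(** * Counting misplaced vertices *)

Section MisplacedVertices.
Variables (R : realType) (n k m : nat) (theta : labeling n k) (xi : R).
Hypotheses (card_community : forall j, #|community theta j| = m) (m6 : (6 <= m)%N).
Hypotheses (xi_ge0 : 0 <= xi) (xi_lt : xi < 1 / 3).
Implicit Types (t : labeling n k) (a b : 'I_k).

Let accurate : {set labeling n k} := [set t | loss R t theta <= xi]%SET.

Lemma sum_indicator_neq a c :
  \sum_(b | b != a) (c == b)%:R = (c != a)%:R :> R.
Proof.
rewrite big_mkcond (bigD1 c) //= eqxx big1 ?addr0; first by case: (c != a).
by move=> b bc; rewrite [c == b]eq_sym (negbTE bc) if_same.
Qed.

(** The factor 2 in the loss turns a loss below 1/3 into error fractions below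
    1/6. *)
Lemma accurate_aligned t : t \in accurate ->
  exists sigma, [/\ aligned theta t sigma,
    forall j, (6 * misclassified theta t sigma j < #|community theta j|)%N
  & forall j, (misclassified theta t sigma j)%:R <= xi / 2 * m%:R :> R].
Proof.
rewrite inE => t_acc.
have [j|sigma le_mis] := loss_le_misclassified _ t_acc.
  by rewrite card_community; lia.
have m0 : 0 < m%:R :> R by rewrite ltr0n; lia.
have lt_mis j : (6 * misclassified theta t sigma j < #|community theta j|)%N.
  rewrite card_community -(ltr_nat R) natrM.
  have := le_mis j; rewrite card_community.
  have := ltr_pM2r m0 xi (1 / 3); rewrite xi_lt; lra.
exists sigma; split => // [|j]; last by rewrite -(card_community j).
by apply/forallP => j; have := lt_mis j; lia.
Qed.

(** An accurate labelling misplaces at most m xi / 2 vertices of a. For any other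
    labelling each vertex is still placed in at most one community, by uniqueness
    of the matching of label names, and the trivial bound m applies. *)
Lemma sum_assigned_away a t :
  \sum_(b | b != a) \sum_(u in community theta a) (t \in assigned theta u b)%:R
  <= m%:R * (1 - (t \in accurate)%:R * (1 - xi / 2)).
Proof.
rewrite exchange_big /=; have [t_acc|_] := boolP (t \in accurate); last first.
  rewrite mul0r subr0 mulr1 -(card_community a) -sum1_card natr_sum.
  apply: ler_sum => u _.
  have [/existsP[sigma al]|/existsPn no_al] := boolP [exists s, aligned theta t s].
    under eq_bigr do rewrite (mem_assigned _ _ al).
    by rewrite sum_indicator_neq lern1 leq_b1.
  rewrite big1 // => b _; rewrite inE; case: existsP => // -[s /andP[al _]].
  by have := no_al s; rewrite al.
have [sigma [al _ le_mis]] := accurate_aligned t_acc.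
apply: (@le_trans _ _ (misclassified theta t sigma a)%:R).
  under eq_bigr => u _ do under eq_bigr do rewrite (mem_assigned _ _ al).
  under eq_bigr do rewrite sum_indicator_neq.
  rewrite /misclassified -sum1_card natr_sum big_mkcond [leRHS]big_mkcond.
  apply: ler_sum => i _; rewrite !inE.
  by case: (theta i == a); case: (sigma _ != a).
by apply: le_trans (le_mis a) _; rewrite mul1r; lra.
Qed.

(** After the exchange u carries the label of v, and the matching of label names
    does not change; thus u is placed in b as soon as v was placed correctly. *)
Lemma sum_assigned_swapped a b (u : 'I_n) t :
    u \in community theta a -> b != a ->
  m%:R * ((t \in accurate)%:R * (1 - xi / 2))
  <= \sum_(v in community theta b)
       (relabel (tperm u v) t \in assigned theta u b)%:R :> R.
Proof.
rewrite inE => /eqP ua ba; have [t_acc|_] := boolP (t \in accurate); last first.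
  by rewrite mul0r mulr0; apply: sumr_ge0.
have [sigma [al lt_mis le_mis]] := accurate_aligned t_acc.
rewrite (eq_bigr (fun v => (sigma (t v) == b)%:R)); last first.
  move=> v; rewrite inE => /eqP vb; rewrite (@mem_assigned _ _ _ _ sigma).
    by rewrite ffunE tpermL.
  apply: aligned_swap => //; first by move=> j; rewrite card_community.
  by rewrite ua vb eq_sym.
rewrite sum_assigned_in_home card_community.
by have := le_mis b; rewrite mul1r; lra.
Qed.

(** Sum the invariance inequality for the events of placing u in b over u in a,
    v in b and b different from a. The left side is bounded below by
    [sum_assigned_swapped], the right side above by [sum_assigned_away]; a common
    factor m^2 cancels. *)
Lemma swap_invariance_bound (Q : fdist R (labeling n k)) (c d : R) : (0 < k)%N ->
    0 <= c ->
    (forall (u v : 'I_n) (S : {set labeling n k}),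
       Pr Q [set t | relabel (tperm u v) t \in S]%SET <= c * Pr Q S + d) ->
  (k%:R - 1) * (Pr Q accurate * (1 - xi / 2) - d)
  <= c * (1 - Pr Q accurate * (1 - xi / 2)).
Proof.
move=> k0 c0 swapQ; pose a := Ordinal k0.
have m0 : 0 < m%:R :> R by rewrite ltr0n; lia.
have num_b : \sum_(b | b != a) 1 = k%:R - 1 :> R.
  rewrite sumr_const cardC1 card_ord.
  by rewrite -subn1 natrB.
pose p := Pr Q accurate * (1 - xi / 2).
have lo b u : b != a -> u \in community theta a ->
    m%:R * p <= \sum_(v in community theta b)
      Pr Q [set t | relabel (tperm u v) t \in assigned theta u b]%SET.
  move=> ba ua; under eq_bigr do rewrite PrE.
  rewrite exchange_big /p PrE /= mulr_suml mulr_sumr; apply: ler_sum => t _.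
  rewrite -mulrA mulrCA -mulr_sumr; apply: ler_wpM2l; first exact: Defs.pmf_ge0.
  under eq_bigr do rewrite inE.
  exact: (sum_assigned_swapped t ua ba).
have hi : \sum_(b | b != a) \sum_(u in community theta a) Pr Q (assigned theta u b)
    <= m%:R * (1 - p).
  under eq_bigr => b _ do under eq_bigr do rewrite PrE.
  under eq_bigr => b _ do rewrite exchange_big /=.
  rewrite exchange_big /= /p PrE -[X in X - _](Defs.pmf_sum1 Q) mulr_suml.
  rewrite -sumrB mulr_sumr; apply: ler_sum => t _.
  under eq_bigr do rewrite -mulr_sumr.
  rewrite -mulr_sumr -mulrA -[X in X - _]mulr1 -mulrBr mulrCA.
  by apply: ler_wpM2l; [exact: Defs.pmf_ge0 | exact: sum_assigned_away].
have sumC j (x : R) : \sum_(v in community theta j) x = m%:R * x.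
  by rewrite sumr_const card_community mulr_natl.
(* One factor m for the choice of u, one for the choice of v. *)
rewrite -(ler_pM2l m0) -(ler_pM2l m0) -/p.
apply: (@le_trans _ _ (\sum_(b | b != a) \sum_(u in community theta a)
   (m%:R * (c * Pr Q (assigned theta u b))))); last first.
  under eq_bigr do rewrite -!mulr_sumr.
  rewrite -!mulr_sumr ler_pM2l // mulrCA; exact: ler_wpM2l.
rewrite -num_b mulr_suml !mulr_sumr; apply: ler_sum => b ba.
rewrite mul1r -(sumC a); apply: ler_sum => u ua.
rewrite mulrBr lerBlDr (le_trans (lo b u ba ua)) // -(sumC b) -(sumC b).
by rewrite -big_split; apply: ler_sum => v _.
Qed.
End MisplacedVertices.

(** * The bound for a fixed number of vertices *)

Section PrivacyTradeoff.
Variables (R : realType) (n k : nat) (M : mechanism R n k).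
Variables (theta : labeling n k) (B : 'M[R]_k) (hB : sbm_matrix B).
Variables (eps delta xi eta : R).
Hypotheses (k2 : (2 <= k)%N) (nk6 : 6 <= n%:R / k%:R :> R).
Hypotheses (bal : balanced R theta) (xi_bounds : 0 < xi < 1 / 3).
Hypotheses (symM : symmetric_mechanism M) (dpM : node_DP eps delta M).
Hypothesis acc : 1 - eta <=
  Pr_output (sbm hB theta) M [set t | loss R t theta <= xi]%SET.

(** Privacy for the empty event. *)
Lemma delta_ge0 : 0 <= delta.
Proof.
have g0 : is_graph (const_mx false : 'M[bool]_n).
  by apply/andP; split; [rewrite trmx_const | apply/forallP => i; rewrite mxE].
have n0 : (0 < n)%N.
  by rewrite lt0n; apply: contraTneq nk6 => ->; rewrite mul0r -ltNge.
have := dpM g0 g0 _ finset.set0; rewrite !Pr_set0 mulr0 add0r; apply.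
by exists (Ordinal n0).
Qed.

Lemma eta_ge0 : 0 <= eta.
Proof.
by have := le_trans acc _; rewrite Pr_outputE => /(_ _ (Pr_le1 _ _)); lra.
Qed.

(** The exchange bound contributes the error (k - 1)(1 + e^eps) delta. It is
    absorbed by the two occurrences of 2 k delta, which carry the weights k - 1
    and e^(2 eps): the second suffices when eps >= 0, the first when eps < 0. *)
Lemma privacy_accuracy_tradeoff :
  (k%:R - 1) * (1 - (eta + xi + 2 * k%:R * delta))
  <= expR eps ^+ 2 * (eta + xi + 2 * k%:R * delta).
Proof.
have [xi0 xi3] := andP xi_bounds.
have d0 := delta_ge0; have h0 := eta_ge0.
have k1 : 1 <= k%:R - 1 :> R by rewrite lerBrDr -(natrD _ 1 1) ler_nat.
pose m := #|community theta (Ordinal (ltnW k2))|.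
have cardC j : #|community theta j| = m.
  by apply/eqP; rewrite -(eqr_nat R) !bal.
have m6 : (6 <= m)%N by rewrite -(ler_nat R) bal.
have := swap_invariance_bound cardC m6 (ltW xi0) xi3 (ltnW k2)
  (exprn_ge0 2%N (expR_ge0 eps))
  (fun u v S => output_law_swap hB theta u v S symM dpM).
have := acc; rewrite Pr_outputE; set p := Pr _ _ => le_p.
have p1 : p <= 1 by exact: Pr_le1.
have : 1 - eta - xi <= p * (1 - xi / 2).
  by have : 0 <= xi * (1 - p); [rewrite mulr_ge0 //; lra | lra].
move: (p * _) => q lq bound {le_p p1}.
have E0 := expR_gt0 eps; set E := expR eps in bound E0 *.
have cE : 0 <= E ^+ 2 * (q - (1 - eta - xi)).
  by rewrite mulr_ge0 ?sqr_ge0 //; lra.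
have cK : 0 <= (k%:R - 1) * (q - (1 - eta - xi)) by rewrite mulr_ge0; lra.
have noise : (1 + E) * delta * (k%:R - 1)
    <= (E ^+ 2 + (k%:R - 1)) * (2 * k%:R * delta).
  have : (1 + E) * (k%:R - 1) <= (E ^+ 2 + (k%:R - 1)) * (2 * k%:R).
    have : 0 <= (k%:R - 1) * (E - 1 / 4) ^+ 2.
      by rewrite mulr_ge0 ?sqr_ge0 //; lra.
    have : 0 <= (k%:R - 1) * (k%:R - 1) :> R by rewrite mulr_ge0; lra.
    by have := sqr_ge0 E; lra.
  by move/(ler_wpM2r d0); lra.
lra.
Qed.

Lemma error_gt0 : 0 < eta + xi + 2 * k%:R * delta.
Proof.
have [xi0 _] := andP xi_bounds.
have : 0 <= 2 * k%:R * delta by rewrite !mulr_ge0 ?delta_ge0.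
by have := eta_ge0; lra.
Qed.

(** When 1 - x <= 0 the first logarithm is -oo and the claim is void. *)
Lemma privacy_lower_bound :
  ((1 / 2)%:E * lne ((1 - eta - xi - 2 * k%:R * delta)
                     / (eta + xi + 2 * k%:R * delta))%:E
   + (1 / 2)%:E * lne (k%:R - 1)%:E <= eps%:E)%E.
Proof.
have x0 := error_gt0; have := privacy_accuracy_tradeoff.
rewrite -!addrA -!opprD !addrA; set x := (eta + _ + _) in x0 * => tradeoff.
have k1 : 1 <= k%:R - 1 :> R by rewrite lerBrDr -(natrD _ 1 1) ler_nat.
have [x1|x1] := lerP (1 - x) 0.
  rewrite le0_lneNy ?lee_fin ?pmulr_lle0 ?invr_gt0 //.
  by rewrite gt0_muleNy ?lte_fin // addNye leNye.
have q0 : 0 < (1 - x) / x by exact: divr_gt0.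
have k0 : 0 < k%:R - 1 :> R by lra.
rewrite !lne_EFin // -!EFinM -EFinD lee_fin.
suff : ln ((1 - x) / x * (k%:R - 1)) <= 2 * eps.
  rewrite lnM ?posrE //; lra.
rewrite -[leRHS]expRK ler_ln ?posrE ?expR_gt0 ?mulr_gt0 ?invr_gt0 //.
rewrite expRM_natl mulrAC ler_pdivrMr //; lra.
Qed.
End PrivacyTradeoff.

(** * Rates *)

Section Asymptotics.
Variables (R : realType) (D : set nat).
Implicit Types (f g : nat -> R).

(** One-sided big-O of 1 / g: only upper bounds on the error terms matter. *)
Definition decays f g : Prop :=
  exists2 C : R, 0 < C & \forall n \near within D \oo, f n <= C / g n.

Lemma bigO_decays f g : f =O_ (within D \oo) (fun n => (g n)^-1) ->
  (\forall n \near within D \oo, 0 < g n) -> decays f g.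
Proof.
move=> /eqO_exP[C C0 fC] g0; exists C => //; near=> n.
have gn : 0 < g n by near: n.
apply: le_trans (ler_norm _) _.
rewrite -[(g n)^-1]ger0_norm ?invr_ge0 ?(ltW gn) //.
by near: n.
Unshelve. all: end_near. Qed.

Lemma decays_trans f g h : decays f g -> (\forall n \near within D \oo, 0 < h n) ->
  gtrsim D g h -> decays f h.
Proof.
move=> [C C0 fC] h0 [c c0 gh]; exists (C / c); first exact: divr_gt0.
near=> n; have hn : 0 < h n by near: n.
have -> : C / c / h n = C / (c * h n) by rewrite invfM mulrA.
apply: (@le_trans _ _ (C / g n)); first by near: n.
have cgh : c * h n <= g n by near: n.
by rewrite ler_pM2l // lef_pV2 // posrE ?mulr_gt0 // (lt_le_trans _ cgh) ?mulr_gt0.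
Unshelve. all: end_near. Qed.

Lemma near_powR_gt0 (alpha : R) : \forall n \near within D \oo, 0 < n%:R `^ alpha :> R.
Proof.
apply: cvg_within; near=> n; apply: powR_gt0; rewrite ltr0n.
by near: n; exact: nbhs_infty_gt.
Unshelve. all: end_near. Qed.

Lemma bigO_inv_poly_decays f : bigO_inv_poly D f ->
  exists2 alpha : R, 0 < alpha & decays f (fun n => n%:R `^ alpha).
Proof.
move=> [p [alpha alpha0 [pge _]] fp]; exists alpha => //.
have pow0 := near_powR_gt0 alpha.
apply: (decays_trans _ pow0 pge); apply: bigO_decays fp _.
case: pge => c c0 pge; near=> n.
have pn : c * n%:R `^ alpha <= p n by near: n.
by apply: lt_le_trans pn; rewrite mulr_gt0 //; near: n.
Unshelve. all: end_near. Qed.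

Lemma near_ln_ge (A : R) : \forall n \near within D \oo, A <= ln n%:R.
Proof.
apply: cvg_within; near=> n; rewrite -[A]expRK.
have An : expR A <= n%:R by near: n; exact: nbhs_infty_ger.
by rewrite ler_ln ?posrE ?expR_gt0 ?(lt_le_trans (expR_gt0 A)).
Unshelve. all: end_near. Qed.

(** From 1 + y <= e^y at y = alpha ln n. *)
Lemma near_ln_le_powR (alpha : R) :
  \forall n \near within D \oo, alpha * ln n%:R <= n%:R `^ alpha :> R.
Proof.
have := near_powR_gt0 alpha; apply: filterS => n pow0.
rewrite -ln_powR -[leRHS]lnK ?posrE //; apply: le_trans (expR_ge1Dx _).
by rewrite lerDr.
Qed.

(** Once g >= 2 C the error x is at most 1/2, so that E = e^(2 e) satisfies
    g <= 2 C E. Once g >= (2 C)^2 as well, squaring gives g <= E^2 = e^(4 e),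
    which absorbs the constant and yields e >= (ln g) / 4. *)
Lemma decays_lower_bound (e x g : nat -> R) :
    (\forall n \near within D \oo, 0 <= x n) ->
    (\forall n \near within D \oo, 1 - x n <= expR (e n) ^+ 2 * x n) ->
    decays x g -> (forall A, \forall n \near within D \oo, A <= g n) ->
  gtrsim D e (fun n => ln (g n)).
Proof.
move=> x0 tradeoff [C C0 xC] g_oo; exists (1 / 4) => //; near=> n => /=.
have gC : 2 * C <= g n by near: n.
have gC2 : (2 * C) ^+ 2 <= g n by near: n.
have xn0 : 0 <= x n by near: n.
have xgC : x n * g n <= C.
  rewrite -ler_pdivlMr; [by near: n | lra].
have te : 1 - x n <= expR (e n) ^+ 2 * x n by near: n.
set E := expR (e n) ^+ 2 in te.
have E0 : 0 < E by rewrite exprn_gt0 ?expR_gt0.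
have gE : g n <= 2 * C * E.
  have : (1 - x n) * g n <= E * x n * g n by rewrite ler_wpM2r //; lra.
  have : E * (x n * g n) <= E * C by rewrite ler_pM2l.
  lra.
suff : g n <= expR (4 * e n).
  have gn0 : 0 < g n by lra.
  rewrite -(ler_ln) ?posrE ?expR_gt0 // expRK; lra.
rewrite expRM_natl (_ : 4 = 2 * 2)%N // exprM -/E -(@ler_pM2l _ (g n)); last lra.
apply: (@le_trans _ _ ((2 * C * E) ^+ 2)).
  by rewrite -expr2 lerXn2r ?nnegrE //; nra.
by rewrite exprMn; apply: ler_wpM2r => //; apply: exprn_ge0; lra.
Unshelve. all: end_near. Qed.

End Asymptotics.

Theorem corollary3 (R : realType) (D : set nat)
    (k : nat -> nat)
    (theta : forall n, labeling n (k n))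
    (B : forall n, 'M[R]_(k n))
    (M : forall n, mechanism R n (k n))
    (eps delta xi eta : nat -> R)
    (k_ge2 : forall n, D n -> (2 <= k n)%N)
    (size_ge6 : forall n, D n -> 6 <= n%:R / (k n)%:R :> R)
    (theta_balanced : forall n, D n -> balanced R (theta n))
    (k_asymp1 : asymp D (fun n => (k n)%:R : R) (fun=> 1))
    (M_symmetric : forall n, D n -> symmetric_mechanism (M n))
    (M_DP : forall n, D n -> node_DP (eps n) (delta n) (M n))
    (B_sbm : forall n, D n -> sbm_matrix (B n))
    (xi_bounds : forall n, D n -> 0 < xi n < 1 / 3)
    (M_accurate : forall n (Dn : D n),
      Pr_output (sbm (B_sbm n Dn) (theta n)) (M n)
        [set t | loss R t (theta n) <= xi n]%SET >= 1 - eta n) :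
  [/\ forall n, D n ->
        ((1 / 2)%:E * lne ((1 - eta n - xi n - 2 * (k n)%:R * delta n)
                           / (eta n + xi n + 2 * (k n)%:R * delta n))%:E
         + (1 / 2)%:E * lne ((k n)%:R - 1)%:E <= (eps n)%:E)%E,
      bigO_inv_poly D eta -> bigO_inv_poly D xi -> bigO_inv_poly D delta ->
        gtrsim D eps (fun n => ln n%:R)
    & eta =O_ (within D \oo) (fun n => (ln n%:R)^-1) ->
      bigO_inv_poly D xi -> bigO_inv_poly D delta ->
        gtrsim D eps (fun n => ln (ln n%:R))].
Proof.
pose x n := eta n + xi n + 2 * (k n)%:R * delta n.
(* As k is eventually bounded on D, the rate of x is the worst of the three rates. *)
have lower_bound g : (forall A, \forall n \near within D \oo, A <= g n) ->
    decays D eta g -> decays D xi g -> decays D delta g ->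
    gtrsim D eps (fun n => ln (g n)).
  move=> g_oo eta_g xi_g delta_g; apply: (decays_lower_bound (x := x)) => //.
  - apply: filterS (near_withinT _ _) => n Dn; apply: ltW.
    exact: error_gt0 (size_ge6 _ Dn) (xi_bounds _ Dn) (M_DP _ Dn) (M_accurate _ Dn).
  - apply: filterS (near_withinT _ _) => n Dn.
    have := privacy_accuracy_tradeoff (k_ge2 _ Dn) (size_ge6 _ Dn)
      (theta_balanced _ Dn) (xi_bounds _ Dn) (M_symmetric _ Dn) (M_DP _ Dn)
      (M_accurate _ Dn).
    have k1 : 1 <= (k n)%:R - 1 :> R.
      by rewrite lerBrDr -(natrD _ 1 1) ler_nat k_ge2.
    have E0 : 0 <= expR (eps n) ^+ 2 by rewrite exprn_ge0 ?expR_ge0.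
    have x0 : 0 < x n.
      exact: error_gt0 (size_ge6 _ Dn) (xi_bounds _ Dn) (M_DP _ Dn) (M_accurate _ Dn).
    rewrite -/(x n); have [x1 _|x1] := lerP (1 - x n) 0.
      by rewrite (le_trans x1) // mulr_ge0 // ltW.
    by apply: le_trans; rewrite ler_peMl // ltW.
  - case: k_asymp1 => _ [c c0 kc].
    case: eta_g => C1 C10 eta_g; case: xi_g => C2 C20 xi_g.
    case: delta_g => C3 C30 delta_g.
    exists (C1 + C2 + 2 / c * C3).
      by rewrite !addr_gt0 ?mulr_gt0 ?invr_gt0.
    near=> n.
    have Dn : D n by near: n; exact: near_withinT.
    have e_n : eta n <= C1 / g n by near: n.
    have x_n : xi n <= C2 / g n by near: n.
    have d_n : delta n <= C3 / g n by near: n.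
    have k_n : c * (k n)%:R <= 1 by near: n.
    have d0 := delta_ge0 (size_ge6 _ Dn) (M_DP _ Dn).
    have kc_n : (k n)%:R <= c^-1 by rewrite -[_^-1]mul1r ler_pdivlMr // mulrC.
    have : (k n)%:R * delta n <= c^-1 * (C3 / g n) by rewrite ler_pM.
    rewrite /x; lra.
split=> [n Dn|O_eta O_xi O_delta|O_eta O_xi O_delta].
- exact: privacy_lower_bound (k_ge2 _ Dn) (size_ge6 _ Dn) (theta_balanced _ Dn)
    (xi_bounds _ Dn) (M_symmetric _ Dn) (M_DP _ Dn) (M_accurate _ Dn).
- have [a1 a10 eta_a] := bigO_inv_poly_decays O_eta.
  have [a2 a20 xi_a] := bigO_inv_poly_decays O_xi.
  have [a3 a30 delta_a] := bigO_inv_poly_decays O_delta.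
  pose a := Num.min a1 (Num.min a2 a3).
  have a0 : 0 < a by rewrite !lt_min a10 a20.
  have to_a b (f : nat -> R) : a <= b -> decays D f (fun n => n%:R `^ b) ->
      decays D f (fun n => n%:R `^ a).
    move=> ab fb; apply: (decays_trans fb (near_powR_gt0 _ _)).
    exists 1 => //; near=> n; rewrite mul1r ler_powR // ler1n.
    by near: n; apply: cvg_within; exact: nbhs_infty_gt.
  have [||||c c0 le_eps] := lower_bound (fun n => n%:R `^ a).
  + move=> A; near=> n.
    apply: (@le_trans _ _ (a * ln n%:R)); last by near: n; exact: near_ln_le_powR.
    by rewrite -ler_pdivrMl //; near: n; exact: near_ln_ge.
  + by apply: to_a eta_a; rewrite /a ge_min lexx.
  + by apply: to_a xi_a; rewrite /a !ge_min lexx !orbT.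
  + by apply: to_a delta_a; rewrite /a !ge_min lexx !orbT.
  exists (c * a); first exact: mulr_gt0.
  apply: filterS le_eps => n; by rewrite ln_powR mulrA.
- have ln0 : \forall n \near within D \oo, 0 < ln n%:R :> R.
    by apply: filterS (near_ln_ge D 1) => n; apply: lt_le_trans.
  have poly_ln (f : nat -> R) : bigO_inv_poly D f -> decays D f (fun n => ln n%:R).
    case/bigO_inv_poly_decays => a a0 fa; apply: (decays_trans fa ln0).
    by exists a => //; exact: near_ln_le_powR.
  apply: lower_bound; [exact: near_ln_ge | | exact: poly_ln | exact: poly_ln].
  exact: bigO_decays.
Unshelve. all: by end_near. Qed.
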